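(* Suppose that $G$ is a virtually poly-positive group. Let $R$ be a finitely generated associative ring (with identity) of characteristic zero such that any nonzero ideal of $R$ is of finite index (e.g. the ring of algebraic integers in a number field). Let $n\geq 3$ and suppose that $S<E_n(R)$ is a finite-index subgroup of the elementary group. Then any group homomorphism $f:S\to G$ has finite image.
   Context: A function $l:G\to[0,\infty)$ on a group $G$ is a length function if (1) $l(g^n)=|n|\,l(g)$ for all $g\in G$, $n\in\mathbb{Z}$; (2) $l(hgh^{-1})=l(g)$ for all $g,h\in G$; (3) $l(ab)\le l(a)+l(b)$ for all commuting elements $a,b\in G$. It is purely positive if $l(g)>0$ for every infinite-order element $g$. A group $G$ is virtually poly-positive if there is a finite-index subgroup $H<G$ and a subnormal series $1=H_m\vartriangleleft H_{m-1}\vartriangleleft\cdots\vartriangleleft H_0=H$ such that every finitely generated subgroup of each quotient $H_i/H_{i+1}$ ($i=0,\dots,m-1$) has a purely positive length function. Rings are associative with identity, and ideal means two-sided ideal. $E_n(R)\le \mathrm{GL}_n(R)$ is the subgroup generated by the elementary matrices $e_{ij}(r)$ ($1\le i\ne j\le n$, $r\in R$), where $e_{ij}(r)$ has $1$'s on the diagonal, $r$ in position $(i,j)$ and zeros elsewhere. *)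

(* Defs.v *)
From HB Require Import structures.
From mathcomp Require Import all_boot all_order all_algebra.
From mathcomp Require Import boolp classical_sets cardinality reals.

Set Implicit Arguments.
Unset Strict Implicit.
Unset Printing Implicit Defensive.

Import Order.TTheory GRing.Theory Num.Theory.

Local Open Scope classical_set_scope.
Local Open Scope group_scope.

(* Groups are MathComp's [groupType]s: possibly infinite, not necessarily
   abelian, written multiplicatively in [group_scope]. *)

Section Subgroups.
Variable G : groupType.

Record subgroup := Subgroup {
  subgroup_set :> set G;
  subgroup_closed : group_closed [in subgroup_set] }.

Record subgroup_sort (H : subgroup) := SubgroupElt {
  subgroup_val : G;
  subgroup_valP : subgroup_val \in subgroup_set H }.

HB.instance Definition _ (H : subgroup) := [isSub for @subgroup_val H].
HB.instance Definition _ (H : subgroup) := [Choice of subgroup_sort H by <:].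
HB.instance Definition _ (H : subgroup) :=
  SubChoice_isSubGroup.Build G [in subgroup_set H] (subgroup_sort H)
    (subgroup_closed H).

Definition generated (A : set G) : set G :=
  smallest (fun H : set G => group_closed [in H]) A.

Definition lcoset (H : set G) (x : G) : set G := [set x * h | h in H].
Definition rcoset (H : set G) (x : G) : set G := [set h * x | h in H].

Definition finite_index (H K : set G) : Prop :=
  H `<=` K /\ finite_set [set lcoset H x | x in K].

Definition normaliser (N : set G) : set G :=
  [set x | lcoset N x = rcoset N x].

Definition normal (N H : set G) : Prop := N `<=` H /\ H `<=` normaliser N.

End Subgroups.

(* As for MathComp's finite groups, the ambient quotient type [coset_of N] is
   (normaliser of N) / N, which is defined for every subgroup N; the quotient
   H / N, for N normal in H, is the set [quotient H N] of its elements. *)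
Section Quotients.
Variables (G : groupType) (N : subgroup G).

Record coset_of := Coset {
  coset_set : set G;
  coset_setP : `[< exists2 x, normaliser N x & coset_set = lcoset N x >] }.

HB.instance Definition _ := [isSub for coset_set].
HB.instance Definition _ := [Choice of coset_of by <:].

Let N1 : subgroup_set N 1.
Proof. by have [/set_mem] := subgroup_closed N. Qed.

Let NM x y : subgroup_set N x -> subgroup_set N y -> subgroup_set N (x * y).
Proof.
move=> Nx Ny; apply: set_mem.
by apply: (group_closedM (subgroup_closed N)); apply: mem_set.
Qed.

Let NV x : subgroup_set N x -> subgroup_set N x^-1.
Proof.
move=> Nx; apply: set_mem.
by apply: (group_closedV (subgroup_closed N)); apply: mem_set.
Qed.

Let norm_r x h : normaliser N x -> subgroup_set N h ->
  exists2 k, subgroup_set N k & h * x = x * k.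
Proof.
move=> nx Nh; have : rcoset N x (h * x) by exists h.
by rewrite -nx => -[k Nk <-]; exists k.
Qed.

Let norm_l x h : normaliser N x -> subgroup_set N h ->
  exists2 k, subgroup_set N k & x * h = k * x.
Proof.
move=> nx Nh; have : lcoset N x (x * h) by exists h.
by rewrite nx => -[k Nk <-]; exists k.
Qed.

Let norm1 : normaliser N 1.
Proof.
by apply/seteqP; split=> _ [h Nh <-]; exists h; rewrite ?mul1g ?mulg1.
Qed.

Let normM x y : normaliser N x -> normaliser N y -> normaliser N (x * y).
Proof.
move=> nx ny; apply/seteqP; split=> _ [h Nh <-].
  have [k Nk e] := norm_l ny Nh; have [j Nj e'] := norm_l nx Nk.
  by exists j; rewrite // mulgA -e' -[RHS]mulgA e mulgA.
have [k Nk e] := norm_r nx Nh; have [j Nj e'] := norm_r ny Nk.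
by exists j; rewrite // [RHS]mulgA e -[LHS]mulgA -e' mulgA.
Qed.

Let normV x : normaliser N x -> normaliser N x^-1.
Proof.
move=> nx; apply/seteqP; split=> _ [h Nh <-].
  have [k Nk e] := norm_r nx Nh.
  by exists k => //; apply: (mulgI x); rewrite mulgA -e mulgK mulgA mulgV mul1g.
have [k Nk e] := norm_l nx Nh.
by exists k => //; apply: (mulgI x); rewrite !mulgA mulgV mul1g e mulgK.
Qed.

Let coset_mulE x y : normaliser N y ->
  [set a * b | a in lcoset N x & b in lcoset N y] = lcoset N (x * y).
Proof.
move=> ny; apply/seteqP; split.
  move=> _ [_ [h Nh <-] [_ [k Nk <-] <-]].
  have [j Nj e] := norm_r ny Nh.
  by exists (j * k); [exact: NM | rewrite -!mulgA (mulgA h) e !mulgA].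
move=> _ [h Nh <-]; exists x; first by exists 1; rewrite ?mulg1.
by exists (y * h); [exists h | rewrite mulgA].
Qed.

Let coset_invE x : normaliser N x ->
  [set a^-1 | a in lcoset N x] = lcoset N x^-1.
Proof.
move=> nx; rewrite (normV nx); apply/seteqP; split.
  by move=> _ [_ [h Nh <-] <-]; exists h^-1; [exact: NV | rewrite invgM].
move=> _ [h Nh <-]; exists (x * h^-1); first by exists h^-1; first exact: NV.
by rewrite invgM invgK.
Qed.

Let cosetP (A : coset_of) :
  exists2 x, normaliser N x & val A = lcoset N x.
Proof. by have /asboolP := valP A. Qed.

Fact coset_one_subproof :
  `[< exists2 x, normaliser N x & subgroup_set N = lcoset N x >].
Proof.
apply/asboolP; exists 1 => //.
by apply/seteqP; split=> [h Nh|_ [h Nh <-]]; [exists h|]; rewrite ?mul1g.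
Qed.

Fact coset_mul_subproof (A B : coset_of) :
  `[< exists2 x, normaliser N x &
        [set a * b | a in val A & b in val B] = lcoset N x >].
Proof.
apply/asboolP; have [x nx ->] := cosetP A; have [y ny ->] := cosetP B.
by exists (x * y); [exact: normM | exact: coset_mulE].
Qed.

Fact coset_inv_subproof (A : coset_of) :
  `[< exists2 x, normaliser N x & [set a^-1 | a in val A] = lcoset N x >].
Proof.
apply/asboolP; have [x nx ->] := cosetP A.
by exists x^-1; [exact: normV | exact: coset_invE].
Qed.

Definition coset_one : coset_of := Coset coset_one_subproof.
Definition coset_mul (A B : coset_of) : coset_of :=
  Coset (coset_mul_subproof A B).
Definition coset_inv (A : coset_of) : coset_of :=
  Coset (coset_inv_subproof A).

Let coset_one_val : val coset_one = lcoset N 1.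
Proof.
by apply/seteqP; split=> [h Nh|_ [h Nh <-]]; [exists h|]; rewrite ?mul1g.
Qed.

Let coset_mul_val A B x y : normaliser N y ->
  val A = lcoset N x -> val B = lcoset N y ->
  val (coset_mul A B) = lcoset N (x * y).
Proof. by move=> ny eA eB; rewrite /= eA eB coset_mulE. Qed.

Let coset_inv_val A x : normaliser N x ->
  val A = lcoset N x -> val (coset_inv A) = lcoset N x^-1.
Proof. by move=> nx eA; rewrite /= eA coset_invE. Qed.

Fact coset_mulA : associative coset_mul.
Proof.
move=> A B C; apply: val_inj.
have [x nx eA] := cosetP A; have [y ny eB] := cosetP B.
have [z nz eC] := cosetP C.
rewrite (coset_mul_val (normM ny nz) eA (coset_mul_val nz eB eC)).
by rewrite (coset_mul_val nz (coset_mul_val ny eA eB) eC) mulgA.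
Qed.

Fact coset_mul1 : left_id coset_one coset_mul.
Proof.
move=> A; apply: val_inj; have [x nx eA] := cosetP A.
by rewrite (coset_mul_val nx coset_one_val eA) mul1g.
Qed.

Fact coset_mulr1 : right_id coset_one coset_mul.
Proof.
move=> A; apply: val_inj; have [x nx eA] := cosetP A.
by rewrite (coset_mul_val norm1 eA coset_one_val) mulg1.
Qed.

Fact coset_mulV : left_inverse coset_one coset_inv coset_mul.
Proof.
move=> A; apply: val_inj; have [x nx eA] := cosetP A.
by rewrite (coset_mul_val nx (coset_inv_val nx eA) eA) mulVg coset_one_val.
Qed.

Fact coset_mulrV : right_inverse coset_one coset_inv coset_mul.
Proof.
move=> A; apply: val_inj; have [x nx eA] := cosetP A.
by rewrite (coset_mul_val (normV nx) eA (coset_inv_val nx eA)) mulgV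
  coset_one_val.
Qed.

HB.instance Definition _ :=
  isGroup.Build coset_of coset_mulA coset_mul1 coset_mulr1
    coset_mulV coset_mulrV.

Definition quotient (H : set G) : set coset_of :=
  [set A | exists2 x, H x & val A = lcoset N x].

End Quotients.

Arguments quotient {G} N H _.

Section LengthFunctions.
Variable K : realType.

Definition expgz (G : groupType) (g : G) (n : int) : G :=
  match n with Posz k => g ^+ k | Negz k => g ^- k.+1 end.

Definition length_function (G : groupType) (l : G -> K) : Prop :=
  [/\ forall g, (0 <= l g)%R,
      forall g (n : int), l (expgz g n) = (`|n|%:~R * l g)%R,
      forall g h, l (h * g * h^-1) = l g &
      forall a b, commute a b -> (l (a * b)%g <= l a + l b)%R].

Definition infinite_order (G : groupType) (g : G) : Prop :=
  forall k : nat, (0 < k)%N -> g ^+ k <> 1.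

Definition purely_positive (G : groupType) (l : G -> K) : Prop :=
  forall g, infinite_order g -> (0 < l g)%R.

Definition fg_subgroup (G : groupType) (F : set G) : Prop :=
  exists s : seq G, F = generated [set` s].

Definition poly_positive (G : groupType) (H : set G) : Prop :=
  exists (m : nat) (H_ : nat -> subgroup G),
    [/\ subgroup_set (H_ 0%N) = H, subgroup_set (H_ m) = [set 1] &
      forall i, (i < m)%N ->
        normal (H_ i.+1) (H_ i) /\
        forall F : subgroup (coset_of (H_ i.+1)),
          F `<=` quotient (H_ i.+1) (H_ i) -> fg_subgroup F ->
          exists l : subgroup_sort F -> K,
            length_function l /\ purely_positive l].

Definition virtually_poly_positive (G : groupType) : Prop :=
  exists H : subgroup G, finite_index H [set: G] /\ poly_positive H.

End LengthFunctions.

Section UnitGroup.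
Variable A : pzRingType.

Definition invertible (x : A) : Prop := exists y : A, (x * y = 1 /\ y * x = 1)%R.

(* MathComp's [unitRingType] structure on matrices requires a commutative
   base ring, so the group of units is built here for an arbitrary ring. *)
Record unit_group := UnitElt {
  unit_val : A;
  unit_valP : `[< invertible unit_val >] }.

HB.instance Definition _ := [isSub for unit_val].
HB.instance Definition _ := [Choice of unit_group by <:].

Let unit_groupP (u : unit_group) : invertible (val u).
Proof. exact/asboolP/(valP u). Qed.

Fact unit_one_subproof : `[< invertible 1%R >].
Proof. by apply/asboolP; exists 1%R; rewrite mulr1. Qed.

Fact unit_mul_subproof (u v : unit_group) :
  `[< invertible (val u * val v)%R >].
Proof.
apply/asboolP; have [x [ux xu]] := unit_groupP u.
have [y [vy yv]] := unit_groupP v; exists (y * x)%R; split.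
  by rewrite mulrA -(mulrA (val u)) vy mulr1.
by rewrite mulrA -(mulrA y) xu mulr1.
Qed.

Fact unit_inv_subproof (u : unit_group) :
  `[< invertible (sval (cid (unit_groupP u))) >].
Proof. by apply/asboolP; case: cid => x [ux xu]; exists (val u). Qed.

Definition unit_one : unit_group := UnitElt unit_one_subproof.
Definition unit_mul (u v : unit_group) : unit_group :=
  UnitElt (unit_mul_subproof u v).
Definition unit_inv (u : unit_group) : unit_group :=
  UnitElt (unit_inv_subproof u).

Fact unit_mulA : associative unit_mul.
Proof. by move=> u v w; apply: val_inj; rewrite /= mulrA. Qed.

Fact unit_mul1 : left_id unit_one unit_mul.
Proof. by move=> u; apply: val_inj; rewrite /= mul1r. Qed.

Fact unit_mulr1 : right_id unit_one unit_mul.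
Proof. by move=> u; apply: val_inj; rewrite /= mulr1. Qed.

Fact unit_mulV : left_inverse unit_one unit_inv unit_mul.
Proof. by move=> u; apply: val_inj; rewrite /=; case: cid => x []. Qed.

Fact unit_mulrV : right_inverse unit_one unit_inv unit_mul.
Proof. by move=> u; apply: val_inj; rewrite /=; case: cid => x []. Qed.

HB.instance Definition _ :=
  isGroup.Build unit_group unit_mulA unit_mul1 unit_mulr1 unit_mulV unit_mulrV.

End UnitGroup.

Section Rings.
Variable R : pzRingType.

Definition fg_ring : Prop :=
  exists s : seq R,
    smallest (fun B : set R => subring_closed [in B]) [set` s] = [set: R].

(* [pchar R] being empty is weaker than this when R is not a domain. *)
Definition char_zero : Prop := forall k : nat, (k%:R = 0 :> R)%R -> k = 0%N.

Definition two_sided_ideal (I : set R) : Prop :=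
  zmod_closed [in I] /\
  forall a x, I x -> I (a * x)%R /\ I (x * a)%R.

Definition ideal_finite_index (I : set R) : Prop :=
  finite_set [set [set (x + a)%R | a in I] | x in [set: R]].

Definition GL (n : nat) := unit_group 'M[R]_n.

Definition elementary_mx (n : nat) (i j : 'I_n) (r : R) : 'M[R]_n :=
  (1%:M + r *: delta_mx i j)%R.

Definition E (n : nat) : set (GL n) :=
  generated [set u : GL n |
    exists i j r, i != j /\ val u = elementary_mx i j r].

End Rings.

Arguments E R n _ : clear implicits.

(* Main.v *)
Require Import Defs.
From HB Require Import structures.
From mathcomp Require Import all_boot all_order all_algebra.
From mathcomp Require Import boolp classical_sets cardinality reals.
From mathcomp Require Import zify.

(** Two facts drive the proof: length functions vanish on central commutators,
    and the Steinberg group of a finite ring in rank at least 3 is finite.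

    Length functions.  If [a * b = c * (b * a)] with [c] commuting with [a] and
    [b], then [c ^+ q * a] is conjugate to [a] for every [q], so
    [q * l c <= 2 * l a] and [l c = 0] ([length_heisenberg]).  When the finitely
    generated subgroups of the target carry purely positive length functions,
    [c] is therefore torsion.  Let [T] have finite index in the elementary
    group [E], and let [h] be a homomorphism from [T] to such a target.  Some
    multiple of every root element lies in [T], and the elements
    [e_is(k)], [e_sj(k)], [e_ij(k ^ 2)] form such a triple, so [h] kills
    [e_ij(m)] for some [m > 0]; a further commutator with [e_sj(k r)] shows
    that [h] kills [e_ij(m r)] for all [r], after enlarging [m]
    ([kernel_contains_multiples]).

    Descent.  Let [H_0, ..., H_p] be the subnormal series.  If a finite-index
    subgroup [T] of [E] is mapped into [H_i], apply this to the conjugates of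
    [T] and the induced maps to [H_i / H_{i+1}].  Their kernels are the
    conjugates of the preimage of [H_{i+1}] in [T], and there are finitely many
    of these, so the core in [E] of this preimage contains [e_ij(m r)] for all [r] and a single [m > 0].  In the
    quotient of [E] by this core the root elements satisfy the Steinberg
    relations and depend only on [r] modulo [m R], an ideal that is nonzero
    since the characteristic is zero, hence of finite index.  The quotient is
    finite by [finite_steinberg], so the preimage of [H_{i+1}] again has finite
    index ([finite_index_descend]).  At the end of the series a finite-index
    subgroup is mapped to [1].

    Finite Steinberg groups.  This step replaces any appeal to K-theory or to
    the congruence subgroup property.  For a third index [k], the rank one
    group generated by [X_ij] and [X_ji] normalises the finite sets
    [X_ik X_jk] and [X_ki X_kj], whose commutators contain [X_ij] and [X_ji].
    Its root elements thus have finitely many conjugates and are torsion, and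
    Dietzmann's lemma makes it finite ([finite_rank_one]).  For a simple root
    [(i, j)] write the triangular groups as [U- = X_ji V-] and [U+ = X_ij V+],
    where the rank one group normalises [V-] and [V+].  Then
    [(U- U+)^N = (X_ji X_ij)^N (V- V+)^N], and for large [N] the first factor
    is the whole rank one group.  Hence the finite set [(U- U+)^N] is stable
    under left multiplication by all simple root groups, and it is everything. *)

Set Implicit Arguments.
Unset Strict Implicit.
Unset Printing Implicit Defensive.

Import Order.TTheory GRing.Theory Num.Theory.

Local Open Scope classical_set_scope.
Local Open Scope group_scope.

(** * Subgroups as sets *)

Ltac gsimp :=
  rewrite ?(invgM, invgK, mulgA, mulgK, mulgVK, mulVg, mulgV, mul1g, mulg1).

Section SetGroups.
Variable G : groupType.
Implicit Types (H : set G) (x y : G).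

Definition is_group H : Prop :=
  [/\ H 1, forall x y, H x -> H y -> H (x * y) & forall x, H x -> H x^-1].

Lemma group_closedP H : group_closed [in H] <-> is_group H.
Proof.
split=> [gH|[H1 HM HV]].
  split=> [|x y Hx Hy|x Hx]; apply: set_mem.
  - by case: gH.
  - by apply: (group_closedM gH); apply: mem_set.
  - by apply: (group_closedV gH); apply: mem_set.
split=> [|x y /set_mem Hx /set_mem Hy]; apply: mem_set => //.
by apply: HM => //; apply: HV.
Qed.

Lemma subgroupP (H : subgroup G) : is_group H.
Proof. exact/group_closedP/(subgroup_closed H). Qed.

Lemma is_groupX H x k : is_group H -> H x -> H (x ^+ k).
Proof.
case=> H1 HM _ Hx; elim: k => [|k IH]; first by rewrite expg0.
by rewrite expgS; apply: HM.
Qed.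

Lemma sub_generated (A : set G) : A `<=` generated A.
Proof. by move=> x Ax H [_]; apply. Qed.

Lemma generated_group (A : set G) : is_group (generated A).
Proof.
split=> [H [/group_closedP[]]//|x y gx gy H HA|x gx H HA].
  have [/group_closedP[_ HM _] _] := HA.
  by apply: HM; [exact: gx | exact: gy].
by have [/group_closedP[_ _ HV] _] := HA; apply: HV; exact: gx.
Qed.

Lemma generated_min (A H : set G) : is_group H -> A `<=` H -> generated A `<=` H.
Proof. by move=> gH AH x; apply; split=> //; apply/group_closedP. Qed.

(** The inverse is asked for separately because [P] may be infinite, in which
    case [h * P] inside [P] does not give equality. *)
Definition stabiliser (P : set G) : set G :=
  [set h | forall p, P p -> P (h * p) /\ P (h^-1 * p)].

Lemma stabiliser_group (P : set G) : is_group (stabiliser P).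
Proof.
split=> [p Pp|x y Hx Hy p Pp|x Hx p Pp].
- by rewrite invg1 mul1g.
- split; first by rewrite -mulgA; apply: (Hx _ (Hy _ Pp).1).1.
  by rewrite invgM -mulgA; apply: (Hy _ (Hx _ Pp).2).2.
- by rewrite invgK; have [] := Hx p Pp.
Qed.

Lemma stabiliser_sub (P : set G) : P 1 -> stabiliser P `<=` P.
Proof. by move=> P1 h /(_ 1 P1)[]; rewrite mulg1. Qed.

Lemma generated_sub_stable (A P : set G) : P 1 ->
  (forall x p, A x -> P p -> P (x * p) /\ P (x^-1 * p)) -> generated A `<=` P.
Proof.
move=> P1 AP; apply: subset_trans (stabiliser_sub P1).
by apply: generated_min => [|x Ax p]; [exact: stabiliser_group | exact: AP].
Qed.

Lemma generated_conj (A Y : set G) :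
  (forall x y, A x -> Y y -> Y (x * y * x^-1) /\ Y (x^-1 * y * x)) ->
  forall g y, generated A g -> Y y -> Y (g * y * g^-1).
Proof.
move=> AY g y gg; move: y.
suff : generated A `<=`
    [set h | forall y, Y y -> Y (h * y * h^-1) /\ Y (h^-1 * y * h)].
  by move=> /(_ _ gg) h y /h[].
apply: generated_min => [|x Ax y Yy]; last exact: AY.
split=> [y Yy|x x' Hx Hx' y Yy|x Hx y Yy].
- by rewrite invg1 !mul1g mulg1.
- rewrite invgM !mulgA; split.
    by move: (Hx _ (Hx' _ Yy).1).1; rewrite !mulgA.
  by move: (Hx' _ (Hx _ Yy).2).2; rewrite !mulgA.
- by rewrite invgK; have [] := Hx y Yy.
Qed.

End SetGroups.

(** * Dietzmann's lemma *)

Lemma common_multiple (T : eqType) (s : seq T) (P : T -> nat -> Prop) :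
  (forall a m k, P a m -> P a (m * k)%N) ->
  (forall a, a \in s -> exists2 m, (0 < m)%N & P a m) ->
  exists2 m, (0 < m)%N & forall a, a \in s -> P a m.
Proof.
move=> PM; elim: s => [|a s IH] sP; first by exists 1%N.
have [m m0 Pm] := sP a (mem_head _ _).
have [|M M0 PMs] := IH; first by move=> b bs; apply: sP; rewrite inE bs orbT.
exists (m * M)%N; first by rewrite muln_gt0 m0.
move=> b; rewrite inE => /orP[/eqP->|bs]; first exact: PM.
by rewrite mulnC; apply: PM; apply: PMs.
Qed.

Section Dietzmann.
Variable G : groupType.
Implicit Types (w : seq G) (x : G).

Definition wprod w : G := foldr *%g 1 w.

Lemma wprod_cat u v : wprod (u ++ v) = wprod u * wprod v.
Proof. by elim: u => [|a u IH] /=; rewrite ?mul1g // IH mulgA. Qed.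

Lemma wprod_conj x u : wprod [seq a ^ x | a <- u] = wprod u ^ x.
Proof. by elim: u => [|a u IH] /=; rewrite ?conj1g // IH conjMg. Qed.

(** Moving one factor [x] to the front conjugates the letters on its left
    by [x]: the number of letters stays the same, and so does the number
    of occurrences of [x], as [x] is its own conjugate. *)
Lemma wprod_collect (s : seq G) x j w :
  (forall a b, a \in s -> b \in s -> a ^ b \in s) ->
  all [in s] w -> (j <= count_mem x w)%N ->
  exists w', [/\ all [in s] w', (size w' + j)%N = size w &
                 wprod w = x ^+ j * wprod w'].
Proof.
move=> sJ; elim: j w => [|j IH] w sw; first by exists w; rewrite addn0 mul1g.
move=> lt_j; have xw : x \in w by rewrite -has_pred1 has_count; lia.
have xs : x \in s by exact: (allP sw).
case/splitPr: w / xw sw lt_j => u v; rewrite all_cat /= => /and3P[su _ sv].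
have xu : count_mem x [seq a ^ x | a <- u] = count_mem x u.
  rewrite count_map; apply: eq_count => a /=.
  by rewrite -{2}[x](mulKg x x) -conjgE (inj_eq (conjg_inj x)).
rewrite count_cat /= eqxx => lt_j.
have [||w' [sw' szw' ew']] := IH ([seq a ^ x | a <- u] ++ v).
- rewrite all_cat sv andbT all_map.
  by apply/allP => a au /=; apply: sJ => //; apply: (allP su).
- by rewrite count_cat xu -ltnS -addnS.
exists w'; split=> //.
  by rewrite addnS szw' !size_cat /= size_map addnS.
rewrite expgS -mulgA -ew' !wprod_cat /= wprod_conj conjgE.
by gsimp.
Qed.

Lemma finite_words (s : seq G) B :
  finite_set [set g | exists2 w, all [in s] w & (size w <= B)%N /\ g = wprod w].
Proof.
elim: B => [|B IH].
  apply: (sub_finite_set _ (finite_set1 1)) => g [w _ [+ ->]].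
  by rewrite leqn0 => /nilP->.
apply: (@sub_finite_set _ _ ([set 1] `|` [set a * g | a in [set` s] & g in
   [set g | exists2 w, all [in s] w & (size w <= B)%N /\ g = wprod w]])).
  move=> g [[|a w] /= sw [szw ->]]; [by left | right].
  have /andP[sa sw'] := sw.
  by exists a => //; exists (wprod w) => //; exists w.
rewrite finite_setU; split; first exact: finite_set1.
by apply: finite_image2 => //; exact: finite_seq.
Qed.

Lemma count_pigeonhole (s : seq G) N w :
  all [in s] w -> (size s * N < size w)%N ->
  exists2 x, x \in s & (N < count_mem x w)%N.
Proof.
elim: s w => [|x s IH] w sw lt_w; first by case: w sw lt_w.
have [lt_x|le_x] := ltnP N (count_mem x w).
  by exists x; rewrite ?mem_head.
have [||y ys lt_y] := IH [seq a <- w | a != x].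
- apply/allP => a; rewrite mem_filter => /andP[ax /(allP sw)].
  by rewrite inE (negPf ax).
- rewrite size_filter (@eq_count _ _ (predC (pred1 x))) //.
  move: lt_w; rewrite -(count_predC (pred1 x) w) /= mulSn => lt_w.
  by rewrite -(ltn_add2l N); apply: leq_trans lt_w _; rewrite leq_add2r.
exists y; first by rewrite inE ys orbT.
apply: leq_trans lt_y _; rewrite count_filter.
by apply: sub_count => a /= /andP[].
Qed.

(** If every element of [X] has exponent dividing [N], a word longer than
    [#|X| * N] contains some [x] at least [N] times; collecting these factors
    in front gives [x ^+ N = 1], so the word can be shortened.  All elements are
    therefore words of bounded length. *)
Theorem Dietzmann (X : set G) : finite_set X ->
  (forall x y, X x -> X y -> X (x ^ y)) ->
  (forall x, X x -> exists2 k, (0 < k)%N & x ^+ k = 1) ->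
  finite_set (generated X).
Proof.
move=> /finite_seqP[s ->] XJ Xtor.
have [||N N0 XN] := @common_multiple _ s (fun x k => x ^+ k = 1).
- by move=> x k j e; rewrite expgnA e expg1n.
- by move=> x xs; apply: Xtor.
pose B := (size s * N)%N; apply: sub_finite_set (finite_words s B).
have shorten w : all [in s] w -> (size w <= B + N)%N ->
    exists2 w', all [in s] w' & (size w' <= B)%N /\ wprod w = wprod w'.
  move=> sw szw; have [?|lt_w] := leqP (size w) B; first by exists w.
  have [x xs lt_x] := count_pigeonhole sw lt_w.
  have [w' [sw' szw' ->]] := wprod_collect XJ sw (ltnW lt_x).
  by exists w' => //; rewrite XN // mul1g -(leq_add2r N) szw'.
apply: generated_sub_stable => [|x p xs [w sw [szw ->]]]; first by exists [::].
(* The inverse of [x] is the word [x ^+ N.-1], which keeps words positive. *)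
have xV : x^-1 = wprod (nseq N.-1 x).
  apply: (mulgI x); rewrite mulgV -(XN _ xs) -{1}(prednK N0) expgS.
  by congr (_ * _); elim: N.-1 => //= k <-; rewrite expgS.
have xw k : (k <= N)%N -> exists2 w', all [in s] w' &
    (size w' <= B)%N /\ wprod (nseq k x) * wprod w = wprod w'.
  move=> le_k; rewrite -wprod_cat; apply: shorten.
    by rewrite all_cat all_nseq xs orbT.
  by rewrite size_cat size_nseq addnC leq_add.
split.
  have [w' sw' [szw' e]] := xw 1%N N0.
  by exists w' => //; split=> //; rewrite -e /= mulg1.
have [w' sw' [szw' e]] := xw N.-1 (leq_pred _).
by exists w' => //; split=> //; rewrite xV.
Qed.

End Dietzmann.

(** * Groups with Steinberg relations *)

Definition setM (G : groupType) (A B : set G) : set G :=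
  [set a * b | a in A & b in B].

Lemma setM_in (G : groupType) (A B : set G) a b :
  A a -> B b -> setM A B (a * b).
Proof. by move=> Aa Bb; exists a => //; exists b. Qed.

Lemma finite_setM (G : groupType) (A B : set G) :
  finite_set A -> finite_set B -> finite_set (setM A B).
Proof. exact: finite_image2. Qed.

Lemma ord_third n (i j : 'I_n) : (3 <= n)%N -> exists k : 'I_n, (k != i) && (k != j).
Proof.
move=> n3; case: (pickP (fun k => (k != i) && (k != j))) => [k ?|h]; first by exists k.
suff : (n <= 2)%N by lia.
rewrite -[n]card_ord; apply: leq_trans (card_size [:: i; j]).
apply/subset_leq_card/fintype.subsetP => k _.
by move/negbT: (h k); rewrite negb_and !negbK !inE.
Qed.

(** The multiplicative relation is written without inverses: it says that
    [x i k (a * b)] is the commutator of [x i j a] and [x j k b]. *)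
Record steinberg (G : groupType) (R : pzRingType) n (x : 'I_n -> 'I_n -> R -> G) :
  Prop := Steinberg {
  steinbergD : forall i j a b, i != j -> x i j (a + b)%R = x i j a * x i j b;
  steinberg_commute : forall i j k l a b, i != j -> k != l -> j != k -> i != l ->
    commute (x i j a) (x k l b);
  steinbergM : forall i j k a b, i != j -> j != k -> i != k ->
    x i j a * x j k b = x i k (a * b)%R * (x j k b * x i j a) }.

Section Steinberg.
Variables (G : groupType) (R : pzRingType) (n : nat) (x : 'I_n -> 'I_n -> R -> G).
Hypothesis xS : steinberg x.
Implicit Types (i j k l : 'I_n) (a b c : R).

Lemma steinberg0 i j : i != j -> x i j 0%R = 1.
Proof.
move=> ij; apply: (mulgI (x i j 0%R)).
by rewrite -(steinbergD xS) // addr0 mulg1.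
Qed.

Lemma steinbergN i j a : i != j -> x i j (- a)%R = (x i j a)^-1.
Proof.
move=> ij; apply: (mulgI (x i j a)).
by rewrite -(steinbergD xS) // subrr steinberg0 // mulgV.
Qed.

Lemma steinbergMn i j a (m : nat) : i != j -> x i j (a *+ m)%R = x i j a ^+ m.
Proof.
move=> ij; elim: m => [|m IH]; first by rewrite mulr0n steinberg0.
by rewrite mulrS expgS (steinbergD xS) // IH.
Qed.

Lemma steinberg_commutator i j k a b : i != j -> j != k -> i != k ->
  x i k (a * b)%R = x i j a * x j k b * (x i j a)^-1 * (x j k b)^-1.
Proof. by move=> ij jk ik; rewrite (steinbergM xS) //; gsimp. Qed.

Lemma steinberg_conjl i j k a b : i != j -> j != k -> i != k ->
  x i j a * x j k b * (x i j a)^-1 = x i k (a * b)%R * x j k b.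
Proof. by move=> ij jk ik; rewrite (steinbergM xS) //; gsimp. Qed.

Lemma steinberg_conjr i j k a b : i != j -> j != k -> i != k ->
  x j k b * x i j a * (x j k b)^-1 = x i k (- (a * b))%R * x i j a.
Proof.
move=> ij jk ik; rewrite steinbergN // (steinberg_commutator a b ij jk ik).
by gsimp.
Qed.

Lemma steinberg_conj i j k l a b : i != j -> k != l -> j != k -> i != l ->
  x i j a * x k l b * (x i j a)^-1 = x k l b.
Proof.
by move=> ij kl jk il; rewrite (steinberg_commute xS a b ij kl jk il) mulgK.
Qed.

Definition root_group i j : set G := range (x i j).

Definition root_span (D : rel 'I_n) : set G :=
  generated [set g | exists i j a, [/\ D i j, i != j & g = x i j a]].

Lemma root_span_mem (D : rel 'I_n) i j a :
  D i j -> i != j -> root_span D (x i j a).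
Proof. by move=> Dij ij; apply: sub_generated; exists i, j, a. Qed.

Lemma root_span_group (D : rel 'I_n) : is_group (root_span D).
Proof. exact: generated_group. Qed.

Lemma root_span_stable (D : rel 'I_n) (P : set G) : P 1 ->
  (forall i j a p, D i j -> i != j -> P p -> P (x i j a * p)) ->
  root_span D `<=` P.
Proof.
move=> P1 DP; apply: generated_sub_stable => // _ p [i [j [a [Dij ij ->]]]] Pp.
by rewrite -steinbergN //; split; apply: DP.
Qed.

Lemma root_span_sub (D : rel 'I_n) (H : set G) : is_group H ->
  (forall i j a, D i j -> i != j -> H (x i j a)) -> root_span D `<=` H.
Proof.
move=> gH DH; apply: generated_min => // _ [i [j [a [Dij ij ->]]]].
exact: DH.
Qed.

Lemma root_span_conj (D : rel 'I_n) (Y : set G) :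
  (forall i j a y, D i j -> i != j -> Y y -> Y (x i j a * y * (x i j a)^-1)) ->
  forall g y, root_span D g -> Y y -> Y (g * y * g^-1).
Proof.
move=> DY; apply: generated_conj => _ y [i [j [a [Dij ij ->]]]] Yy.
split; first exact: DY.
by have := DY i j (- a)%R y Dij ij Yy; rewrite steinbergN // invgK.
Qed.

(** The set [D] is closed under adding the root [(i, j)] and does not contain
    its opposite, the one root for which the commutator formula fails. *)
Definition root_stable (D : rel 'I_n) i j :=
  forall k l, D k l -> k != l ->
    [/\ (k, l) <> (j, i), j = k -> D i l & l = i -> D k j].

(** Conjugating a root element by [x i j a] multiplies it by a root element at
    the sum of the two roots. *)
Lemma root_span_normal (D : rel 'I_n) i j : i != j -> root_stable D i j ->
  forall a u, root_span D u -> root_span D (x i j a * u * (x i j a)^-1).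
Proof.
move=> ij Dij a u Du.
have gD := root_span_group D; have [_ DM _] := gD.
have stab c y : [set g | exists k l b, [/\ D k l, k != l & g = x k l b]] y ->
    root_span D (x i j c * y * (x i j c)^-1).
  move=> [k [l [b [Dkl kl ->]]]]; have [opp jk_il li_kj] := Dij k l Dkl kl.
  have [jk|jk] := eqVneq j k.
    have il : i != l by apply: contra_notN opp => /eqP <-; rewrite jk.
    rewrite -jk in kl Dkl *; rewrite steinberg_conjl //; apply: DM.
      by apply: root_span_mem => //; apply: jk_il.
    exact: root_span_mem.
  have [li|li] := eqVneq l i.
    rewrite li in kl Dkl *; rewrite steinberg_conjr // 1?eq_sym //; apply: DM.
      by apply: root_span_mem; rewrite 1?eq_sym //; apply: li_kj.
    exact: root_span_mem.
  by rewrite steinberg_conj // 1?eq_sym //; apply: root_span_mem.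
suff : root_span D `<=` [set u | root_span D (x i j a * u * (x i j a)^-1)].
  exact.
apply: generated_min => [|y /(stab a)//].
split=> [|y z Hy Hz|y Hy] /=.
- by rewrite mulg1 mulgV; case: gD.
- by move: (DM _ _ Hy Hz); gsimp.
- have [_ _ /(_ _ Hy)] := gD; by gsimp.
Qed.

Lemma root_span_split (D D' : rel 'I_n) i j : i != j -> root_stable D' i j ->
  (forall k l, D k l -> k != l -> D' k l \/ (k, l) = (i, j)) ->
  root_span D `<=` setM (root_group i j) (root_span D').
Proof.
move=> ij stab DD'; have [D1 DM _] := root_span_group D'.
apply: root_span_stable => [|k l a _ Dkl kl [_ [b _ <-]] [u D'u <-]].
  by exists 1; [exists 0%R; rewrite ?steinberg0 | exists 1; rewrite ?mulg1].
have [D'kl|[-> ->]] := DD' k l Dkl kl; last first.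
  by rewrite mulgA -(steinbergD xS) //; apply: setM_in => //; exists (a + b)%R.
have -> : x k l a * (x i j b * u) =
    x i j b * (x i j (- b)%R * x k l a * (x i j (- b)%R)^-1 * u).
  by rewrite steinbergN //; gsimp.
apply: setM_in; first by exists b.
by apply: DM => //; apply: root_span_normal => //; apply: root_span_mem.
Qed.

Hypothesis xfin : forall i j, i != j -> finite_set (root_group i j).

(** Upper triangular for [v = id], lower triangular for [v = rev_ord]. *)
Definition positive (v : 'I_n -> 'I_n) : rel 'I_n := fun i j => (v i < v j)%N.

(** List the positive roots in an order in which the sum of two roots comes
    after both.  Adding the roots one at a time, from the last to the first,
    each new root group normalises the group generated so far, so the group is
    a product of finitely many finite root groups. *)
Lemma finite_unipotent (v : 'I_n -> 'I_n) : injective v ->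
  finite_set (root_span (positive v)).
Proof.
move=> vI.
(* The rank [(v l - v k) * n + v k] is injective on pairs because [v k < n], and
   it increases under sums of roots. *)
pose D t : rel 'I_n := fun k l => (v k < v l)%N && (t <= (v l - v k) * n + v k)%N.
have -> : positive v = D 0%N.
  by apply/boolp.funext => k; apply/boolp.funext => l; rewrite /D leq0n andbT.
suff fin s t : (t + s = n * n + n)%N -> finite_set (root_span (D t)).
  exact: (fin (n * n + n)%N).
elim: s t => [|s IH] t ts.
  apply: (sub_finite_set _ (finite_set1 1)).
  apply: root_span_stable => // k l a p /andP[_ Dkl] _ _.
  have vk := ltn_ord (v k); have vl := ltn_ord (v l).
  have : (v l - v k <= n)%N by lia.
  by rewrite -(leq_pmul2r (_ : (0 < n)%N)); lia.
have {IH} finS : finite_set (root_span (D t.+1)) by apply: IH; lia.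
have [/existsP[[i j] /andP[/= vij /eqP tij]]|] :=
    boolP [exists p : 'I_n * 'I_n,
             (v p.1 < v p.2)%N && ((v p.2 - v p.1) * n + v p.1 == t)%N].
  have ij : i != j by apply: contraTneq vij => ->; rewrite ltnn.
  have sub : root_span (D t) `<=` setM (root_group i j) (root_span (D t.+1)).
    apply: root_span_split => // k l /andP[vkl tkl] kl.
      split=> [[kj li]|jk|li].
      - by move: vkl; rewrite kj li ltnNge ltnW.
      - move: vkl tkl; rewrite /D -jk => vjl tjl.
        rewrite (ltn_trans vij vjl) /=.
        have : (v l - v i = (v l - v j) + (v j - v i))%N by lia.
        move=> ->; rewrite mulnDl; have vj := ltn_ord (v j).
        have : (n <= (v j - v i) * n)%N by rewrite leq_pmull //; lia.
        by lia.
      - move: vkl tkl; rewrite /D li => vki tki.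
        rewrite (ltn_trans vki vij) /=.
        have : ((v j - v k) = (v j - v i) + (v i - v k))%N by lia.
        move=> ->; rewrite mulnDl; have vj := ltn_ord (v j).
        have : (n <= (v j - v i) * n)%N by rewrite leq_pmull //; lia.
        by lia.
    have [tkl'|] := ltnP t ((v l - v k) * n + v k).
      by left; rewrite /D vkl.
    move=> tkl'; right.
    have e : ((v l - v k) * n + v k = (v j - v i) * n + v i)%N by lia.
    have eki : v k = v i.
      apply: val_inj; move: (congr1 (modn^~ n) e).
      by rewrite !modnMDl !modn_small.
    have n0 : (0 < n)%N by lia.
    move: e; rewrite eki => /addIn /eqP; rewrite eqn_pmul2r // => /eqP e.
    congr (_, _); apply: vI => //; apply: val_inj => /=.
    by move: vkl; rewrite eki; lia.
  apply: (sub_finite_set sub); apply: finite_setM => //; exact: xfin.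
move=> /existsPn none; apply: sub_finite_set finS.
apply: root_span_sub => [|k l a /andP[vkl tkl] kl]; first exact: root_span_group.
apply: root_span_mem => //; rewrite /D vkl /= ltn_neqAle tkl andbT eq_sym.
by have := none (k, l); rewrite /= vkl.
Qed.

End Steinberg.

(** * Alternating products *)

Section Alternate.
Variable G : groupType.
Implicit Types A B L : set G.

Definition alternate A B N : set G :=
  iter N (fun S => setM A (setM B S)) [set 1].

Lemma finite_alternate A B N :
  finite_set A -> finite_set B -> finite_set (alternate A B N).
Proof.
move=> fA fB; elim: N => [|N IH]; first exact: finite_set1.
by rewrite /alternate iterS; do 2!apply: finite_setM => //.
Qed.

Lemma alternate1 A B N : A 1 -> B 1 -> alternate A B N 1.
Proof.
move=> A1 B1; elim: N => [|N IH] //.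
by exists 1 => //; exists 1; rewrite ?mulg1 //; exists 1 => //; exists 1; rewrite ?mulg1.
Qed.

Lemma sub_alternate A B N M : A 1 -> B 1 -> (N <= M)%N ->
  alternate A B N `<=` alternate A B M.
Proof.
move=> A1 B1 /subnK <-; elim: (M - N)%N => [|k IH] // g /IH hg.
by exists 1 => //; exists g; rewrite ?mul1g //; exists 1 => //; exists g; rewrite ?mul1g.
Qed.

(** Since [L] normalises both [V1] and [V2], all the factors from [X1] and [X2]
    can be moved to the left. *)
Lemma alternate_split (X1 X2 V1 V2 L : set G) N : is_group L ->
  X1 `<=` L -> X2 `<=` L ->
  (forall g v, L g -> V1 v -> V1 (g * v * g^-1)) ->
  (forall g v, L g -> V2 v -> V2 (g * v * g^-1)) ->
  alternate (setM X1 V1) (setM X2 V2) N =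
  setM (alternate X1 X2 N) (alternate V1 V2 N).
Proof.
move=> [L1 LM LV] X1L X2L V1n V2n.
have altL M : alternate X1 X2 M `<=` L.
  elim: M => [_ ->//|M IH _ [a X1a [_ [b X2b [c /IH Lc <-]] <-]]].
  by apply: (LM); [exact: X1L | apply: LM => //; exact: X2L].
apply/seteqP; split; elim: N => [|N IH].
- by move=> _ ->; exists 1 => //; exists 1; rewrite ?mulg1.
- move=> _ [_ [a X1a [u V1u <-]] [_ [_ [b X2b [v V2v <-]]
    [_ /IH[c cN [w wN <-]] <-]] <-]].
  have Lc := altL N _ cN; have Lb := X2L _ X2b; have Lbc := LM _ _ Lb Lc.
  exists (a * (b * c)); first by apply: setM_in => //; apply: setM_in.
  exists ((b * c)^-1 * u * (b * c)^-1^-1 * (c^-1 * v * c^-1^-1 * w)).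
    by apply: setM_in; [apply: V1n | apply: setM_in => //; apply: V2n] => //;
      apply: LV.
  by gsimp.
- by move=> _ [_ -> [_ -> <-]]; rewrite mulg1.
- move=> _ [_ [a X1a [_ [b X2b [c cN <-]] <-]] [_ [u V1u [_ [v V2v [w wN <-]] <-]] <-]].
  have Lc := altL N _ cN; have Lb := X2L _ X2b; have Lbc := LM _ _ Lb Lc.
  have -> : a * (b * c) * (u * (v * w)) = a * (b * c * u * (b * c)^-1) *
    (b * (c * v * c^-1) * (c * w)) by gsimp.
  apply: setM_in; first by apply: setM_in => //; apply: V1n.
  by apply: setM_in; [apply: setM_in => //; apply: V2n | apply/IH/setM_in].
Qed.

Lemma alternate_sub A B L N : is_group L -> A `<=` L -> B `<=` L ->
  alternate A B N `<=` L.
Proof.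
move=> [L1 LM _] AL BL; elim: N => [_ ->//|N IH _ [a Aa [_ [b Bb [c /IH Lc <-]] <-]]].
by apply: (LM); [exact: AL | apply: (LM) => //; exact: BL].
Qed.

Lemma group_sub_alternate A B L : is_group A -> is_group B -> finite_set L ->
  L `<=` generated (A `|` B) -> exists N, L `<=` alternate A B N.
Proof.
move=> [A1 AM AV] [B1 BM BV] /finite_seqP[s ->] sL.
have all_in : generated (A `|` B) `<=` \bigcup_N alternate A B N.
  apply: generated_sub_stable; first by exists 0%N.
  have Ain a p : A a -> (\bigcup_N alternate A B N) p ->
      (\bigcup_N alternate A B N) (a * p).
    move=> Aa [N _ Np]; exists N.+1 => //; apply: setM_in => //.
    by rewrite -[p]mul1g; apply: setM_in.
  have Bin b p : B b -> (\bigcup_N alternate A B N) p ->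
      (\bigcup_N alternate A B N) (b * p).
    move=> Bb [N _ Np]; exists N.+1 => //.
    by rewrite -[b * p]mul1g; do 2!apply: setM_in => //.
  by move=> y p [Ay|By] Pp; split; [apply: Ain|apply: Ain|apply: Bin|apply: Bin];
    auto.
elim: s sL => [|g s IH] sL; first by exists 0%N.
have [|N NP] := IH; first by move=> h hs; apply: sL; rewrite /= inE hs orbT.
have [M _ MP] := all_in g (sL g (mem_head _ _)).
exists (maxn M N) => h; rewrite /= inE => /orP[/eqP->|hs].
  by apply: sub_alternate MP => //; exact: leq_maxl.
by apply: sub_alternate (NP h hs) => //; exact: leq_maxr.
Qed.

End Alternate.

(** * Finiteness of Steinberg groups over finite rings *)

Section SteinbergFinite.
Variables (G : groupType) (R : pzRingType) (n : nat) (x : 'I_n -> 'I_n -> R -> G).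
Hypothesis n3 : (3 <= n)%N.
Hypothesis xS : steinberg x.
Hypothesis xfin : forall i j, i != j -> finite_set (root_group x i j).
Implicit Types (i j k l : 'I_n) (a b c : R).

Variable m : nat.
Hypothesis m_gt0 : (0 < m)%N.
Hypothesis xm : forall i j a, i != j -> x i j (a *+ m)%R = 1.

Let pair_rel i j : rel 'I_n :=
  fun k l => (k, l) \in [:: (i, j); (j, i)].

Definition rank_one i j := root_span x (pair_rel i j).

(** Acting on the column [k], the rank one group preserves the pairs of entries
    in the rows [i] and [j]; this set is symmetric in [i] and [j] because the two
    root groups commute. *)
Lemma rank_one_normal_col i j k : i != j -> i != k -> j != k ->
  forall g y, rank_one i j g -> setM (root_group x i k) (root_group x j k) y ->
  setM (root_group x i k) (root_group x j k) (g * y * g^-1).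
Proof.
move=> ij ik jk.
have sym : setM (root_group x i k) (root_group x j k)
    = setM (root_group x j k) (root_group x i k).
  by apply/seteqP; split=> _ [_ [a _ <-] [_ [b _ <-] <-]];
    (rewrite (steinberg_commute xS) // 1?eq_sym //; apply: setM_in;
     [exists b | exists a]).
have step i' j' c y : i' != j' -> i' != k -> j' != k ->
    setM (root_group x i' k) (root_group x j' k) y ->
    setM (root_group x i' k) (root_group x j' k) (x i' j' c * y * (x i' j' c)^-1).
  move=> ij' ik' jk' [_ [a _ <-] [_ [b _ <-] <-]].
  have -> : x i' j' c * (x i' k a * x j' k b) * (x i' j' c)^-1 =
      x i' k (a + c * b)%R * x j' k b.
    rewrite (steinbergD xS) // -[RHS]mulgA -(steinberg_conjl xS) // !mulgA.
    by rewrite (steinberg_commute xS c a) // eq_sym.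
  by apply: setM_in; [exists (a + c * b)%R | exists b].
apply: (root_span_conj xS) => k' l' c y pkl kl Yy.
move: pkl; rewrite /pair_rel !inE => /orP[] /eqP[? ?]; subst k' l'.
  exact: step.
by rewrite sym in Yy *; apply: step.
Qed.

Lemma rank_one_normal_row i j k : i != j -> i != k -> j != k ->
  forall g y, rank_one i j g -> setM (root_group x k i) (root_group x k j) y ->
  setM (root_group x k i) (root_group x k j) (g * y * g^-1).
Proof.
move=> ij ik jk.
have sym : setM (root_group x k i) (root_group x k j)
    = setM (root_group x k j) (root_group x k i).
  by apply/seteqP; split=> _ [_ [a _ <-] [_ [b _ <-] <-]];
    (rewrite (steinberg_commute xS) // 1?eq_sym //; apply: setM_in;
     [exists b | exists a]).
have step i' j' c y : i' != j' -> i' != k -> j' != k ->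
    setM (root_group x k i') (root_group x k j') y ->
    setM (root_group x k i') (root_group x k j') (x i' j' c * y * (x i' j' c)^-1).
  move=> ij' ik' jk' [_ [a _ <-] [_ [b _ <-] <-]].
  have ki : k != i' by rewrite eq_sym.
  have kj : k != j' by rewrite eq_sym.
  have ji : j' != i' by rewrite eq_sym.
  have -> : x i' j' c * (x k i' a * x k j' b) * (x i' j' c)^-1 =
      x k i' a * x k j' (- (a * c) + b)%R.
    rewrite (steinbergD xS) //.
    have -> : x k i' a * (x k j' (- (a * c))%R * x k j' b) =
        x k j' (- (a * c))%R * x k i' a * x k j' b.
      by rewrite !mulgA (steinberg_commute xS a) //.
    rewrite -(steinberg_conjr xS) //.
    rewrite -!mulgA; congr (_ * (_ * _)).
    by rewrite -(steinbergN xS) // (steinberg_commute xS b) //.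
  by apply: setM_in; [exists a | exists (- (a * c) + b)%R].
apply: (root_span_conj xS) => k' l' c y pkl kl Yy.
move: pkl; rewrite /pair_rel !inE => /orP[] /eqP[? ?]; subst k' l'.
  exact: step.
by rewrite sym in Yy *; apply: step.
Qed.

(** The conjugates of [x i j a = [x i k a, x k j 1]] are commutators of elements
    of the two finite sets [Y] and [Z] normalised by the rank one group, so they
    are finitely many and Dietzmann's lemma applies. *)
Lemma finite_rank_one i j : i != j -> finite_set (rank_one i j).
Proof.
move=> ij; have [k /andP[ki kj]] := ord_third i j n3.
have ik : i != k by rewrite eq_sym.
have jk : j != k by rewrite eq_sym.
pose Y := setM (root_group x i k) (root_group x j k).
pose Z := setM (root_group x k i) (root_group x k j).
have [L1 LM LV] := root_span_group x (pair_rel i j).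
pose X := [set g * y * g^-1 | g in rank_one i j & y in
  root_group x i j `|` root_group x j i].
have Yin i' a : i' \in [:: i; j] -> Y (x i' k a).
  rewrite !inE => /orP[] /eqP->; [rewrite -[x i k a]mulg1 | rewrite -[x j k a]mul1g];
    apply: setM_in; (try by exists a); exists 0%R; rewrite ?(steinberg0 xS) //.
have Zin i' a : i' \in [:: i; j] -> Z (x k i' a).
  rewrite !inE => /orP[] /eqP->; [rewrite -[x k i a]mulg1 | rewrite -[x k j a]mul1g];
    apply: setM_in; (try by exists a); exists 0%R; rewrite ?(steinberg0 xS) //.
have Xfin : finite_set X.
  apply: (@sub_finite_set _ _ [set y * z * y^-1 * z^-1 | y in Y & z in Z]).
    move=> _ [g Lg [y XXy <-]].
    have [u Yu [v Zv ->]] : exists2 u, Y u & exists2 v, Z v & y = u * v * u^-1 * v^-1.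
      case: XXy => -[a _ <-].
        exists (x i k a); first by apply: Yin; rewrite !inE eqxx.
        exists (x k j 1%R); first by apply: Zin; rewrite !inE eqxx orbT.
        by rewrite -(steinberg_commutator xS) ?mulr1.
      exists (x j k a); first by apply: Yin; rewrite !inE eqxx orbT.
      exists (x k i 1%R); first by apply: Zin; rewrite !inE eqxx.
      by rewrite -(steinberg_commutator xS) ?mulr1 // eq_sym.
    exists (g * u * g^-1); first exact: rank_one_normal_col.
    exists (g * v * g^-1); first exact: rank_one_normal_row.
    by gsimp.
  by apply: finite_image2; apply: finite_setM; apply: xfin.
have XL : X `<=` rank_one i j.
  move=> _ [g Lg [y XXy <-]]; apply: (LM); last exact: (LV).
  apply: LM => //; case: XXy => -[a _ <-]; apply: root_span_mem => //;
    by rewrite 1?eq_sym // /pair_rel !inE eqxx ?orbT.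
apply: sub_finite_set (Dietzmann Xfin _ _).
- apply: generated_min; first exact: generated_group.
  move=> _ [k' [l' [c [pkl kl ->]]]]; apply: sub_generated.
  exists 1 => //; exists (x k' l' c); last by rewrite mul1g invg1 mulg1.
  by move: pkl; rewrite /pair_rel !inE => /orP[] /eqP[-> ->]; [left | right];
    exists c.
- move=> _ h [g Lg [y XXy <-]] /XL Lh.
  exists (h^-1 * g); first by apply: LM => //; exact: LV.
  by exists y => //; rewrite conjgE; gsimp.
- move=> _ [g Lg [y XXy <-]]; exists m => //.
  have -> : g * y * g^-1 = y ^ g^-1 by rewrite conjgE; gsimp.
  rewrite -conjXg.
  suff -> : y ^+ m = 1 by rewrite conj1g.
  by case: XXy => -[a _ <-]; rewrite -(steinbergMn xS) ?xm // eq_sym.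
Qed.


Lemma rank_one_exhaust i j : i != j -> exists N,
  rank_one i j `<=` alternate (root_group x j i) (root_group x i j) N.
Proof.
move=> ij; have ji : j != i by rewrite eq_sym.
have grp k l : k != l -> is_group (root_group x k l).
  move=> kl; split=> [|_ _ [a _ <-] [b _ <-]|_ [a _ <-]].
  - by exists 0%R; rewrite ?(steinberg0 xS).
  - by exists (a + b)%R; rewrite ?(steinbergD xS).
  - by exists (- a)%R; rewrite ?(steinbergN xS).
apply: group_sub_alternate; [exact: grp | exact: grp | exact: finite_rank_one |].
apply: generated_min; first exact: generated_group.
move=> _ [k [l [a [+ _ ->]]]].
by rewrite /pair_rel !inE => /orP[] /eqP[-> ->]; apply: sub_generated; [right | left]; exists a.
Qed.

(** Triangular roots other than the simple one.  Removing a simple root, and no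
    other, leaves a set stable under both opposite rank one root groups. *)
Definition positive_but i j : rel 'I_n :=
  fun k l => (k < l)%N && ~~ ((k == i :> nat) && (l == j :> nat)).
Definition negative_but i j : rel 'I_n :=
  fun k l => (l < k)%N && ~~ ((k == j :> nat) && (l == i :> nat)).

Lemma simple_stable i j : j = i.+1 :> nat ->
  [/\ root_stable (positive_but i j) i j, root_stable (positive_but i j) j i,
     root_stable (negative_but i j) i j & root_stable (negative_but i j) j i].
Proof.
move=> ji; rewrite /positive_but /negative_but.
split=> k l Dkl /eqP kl; split=> [[/(congr1 val)/= e1 /(congr1 val)/= e2]
  |/(congr1 val)/= e|/(congr1 val)/= e]; try lia;
  have kl' : val k <> val l by move/val_inj.
all: by lia.
Qed.

Lemma rank_one_stable i j (D : rel 'I_n) : i != j ->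
  root_stable D i j -> root_stable D j i ->
  forall g v, rank_one i j g -> root_span x D v -> root_span x D (g * v * g^-1).
Proof.
move=> ij Dij Dji; apply: (root_span_conj xS) => k l a y.
rewrite /pair_rel !inE => /orP[] /eqP[-> ->] _; apply: (root_span_normal xS) => //.
by rewrite eq_sym.
Qed.

Lemma unipotent_split i j (D D' : rel 'I_n) : i != j -> root_stable D' i j ->
  D i j -> (forall k l, D' k l -> D k l) -> 
  (forall k l, D k l -> k != l -> D' k l \/ (k, l) = (i, j)) ->
  root_span x D = setM (root_group x i j) (root_span x D').
Proof.
move=> ij stab Dij D'D DD'; apply/seteqP; split; first exact: root_span_split.
have gD := root_span_group x D; have [_ DM _] := gD.
move=> _ [_ [a _ <-] [u D'u <-]]; apply: DM; first exact: root_span_mem.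
by apply: root_span_sub D'u => // k l b /D'D; apply: root_span_mem.
Qed.

Lemma simple_roots_generate (H : set G) : is_group H ->
  (forall i j a, (j = i.+1 :> nat) \/ (i = j.+1 :> nat) -> H (x i j a)) ->
  forall i j a, i != j -> H (x i j a).
Proof.
move=> [H1 HM HV] Hs.
have step i k j a : i != k -> k != j -> i != j ->
    H (x i k a) -> H (x k j 1%R) -> H (x i j a).
  move=> ik kj ij Hik Hkj; rewrite -[a]mulr1 (steinberg_commutator xS a 1%R ik kj ij).
  by apply: (HM); [apply: (HM); [exact: (HM) | exact: HV] | exact: HV].
have up d : forall i j a, (j = i + d.+1 :> nat)%N -> H (x i j a).
  elim: d => [|d IH] i j a ji; first by apply: Hs; left; lia.
  have lt_k : (i.+1 < n)%N by have := ltn_ord j; lia.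
  apply: (step i (Ordinal lt_k)); rewrite -?val_eqE /=; try lia.
    by apply: Hs; left.
  by apply: IH => /=; lia.
have down d : forall i j a, (i = j + d.+1 :> nat)%N -> H (x i j a).
  elim: d => [|d IH] i j a ji; first by apply: Hs; right; lia.
  have lt_k : (j.+1 < n)%N by have := ltn_ord i; lia.
  apply: (step i (Ordinal lt_k)); rewrite -?val_eqE /=; try lia.
    by apply: IH => /=; lia.
  by apply: Hs; right.
move=> i j a; rewrite -val_eqE /= neq_ltn => /orP[lt_ij|lt_ij].
  by apply: (up (j - i).-1); lia.
by apply: (down (i - j).-1); lia.
Qed.

(** Both triangular groups factor through any simple root, so the same set
    [(V U)^N] of alternating products can be multiplied by each simple root
    group in turn; the exponent [N] is the largest one needed by a rank one
    group. *)
Theorem finite_steinberg : finite_set (root_span x (fun _ _ => true)).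
Proof.
pose U := root_span x (positive (@id 'I_n)).
pose V := root_span x (positive (@rev_ord n)).
have U1 : U 1 by have [] := root_span_group x (positive (@id 'I_n)).
have V1 : V 1 by have [] := root_span_group x (positive (@rev_ord n)).
have [N NP] : exists N, forall i j, j = i.+1 :> nat ->
    rank_one i j `<=` alternate (root_group x j i) (root_group x i j) N.
  have /choice[f fP] : forall p : 'I_n * 'I_n, exists N, p.2 = p.1.+1 :> nat ->
      rank_one p.1 p.2 `<=` alternate (root_group x p.2 p.1) (root_group x p.1 p.2) N.
    move=> [i j] /=; have [e|ne] := eqVneq (j : nat) i.+1; last first.
      by exists 0%N => e; rewrite e eqxx in ne.
    have ij : i != j by rewrite -val_eqE /= e; lia.
    by have [N ?] := rank_one_exhaust ij; exists N.
  exists (\max_p f p)%N => i j ji; have ij : i != j by rewrite -val_eqE /= ji; lia.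
  apply: subset_trans (fP (i, j) ji) _; apply: sub_alternate.
  - by exists 0%R => //; rewrite (steinberg0 xS) // eq_sym.
  - by exists 0%R => //; rewrite (steinberg0 xS).
  - exact: leq_bigmax.
apply: (@sub_finite_set _ _ (alternate V U N)); last first.
  by apply: finite_alternate; apply: (finite_unipotent xS xfin) => // ;
    exact: rev_ord_inj.
have stable i j : j = i.+1 :> nat -> forall g p, rank_one i j g ->
    alternate V U N p -> alternate V U N (g * p).
  move=> ji g p Lg; have ij : i != j by rewrite -val_eqE /= ji; lia.
  have ji' : j != i by rewrite eq_sym.
  have [p1 p2 n1 n2] := simple_stable ji.
  have L_grp : is_group (rank_one i j) by exact: root_span_group.
  have [_ LM _] := L_grp.
  have -> : V = setM (root_group x j i) (root_span x (negative_but i j)).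
    apply: unipotent_split => //.
    - by rewrite /positive /= ; have := ltn_ord j; lia.
    - move=> k l /andP[lt_lk _]; rewrite /positive /=.
      by have := ltn_ord k; have := ltn_ord l; lia.
    - move=> k l; rewrite /positive /= => lt_kl kl.
      have lt_lk : (l < k)%N by have := ltn_ord k; have := ltn_ord l; lia.
      rewrite /negative_but lt_lk /=; case: eqP => [e1|_]; last by left.
      case: eqP => [e2|_]; last by left.
      by right; congr (_, _); apply: val_inj.
  have -> : U = setM (root_group x i j) (root_span x (positive_but i j)).
    apply: unipotent_split => //.
    - by rewrite /positive /=; lia.
    - by move=> k l /andP[].
    - move=> k l; rewrite /positive /= => lt_kl kl.
      rewrite /positive_but lt_kl /=; case: eqP => [e1|_]; last by left.
      case: eqP => [e2|_]; last by left.
      by right; congr (_, _); apply: val_inj.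
  rewrite (@alternate_split _ _ _ _ _ (rank_one i j)) //.
  - move=> [u uN [v vN <-]]; rewrite mulgA; apply: setM_in => //.
    apply: (NP i j ji); apply: LM => //.
    by apply: alternate_sub uN => // _ [a _ <-]; apply: root_span_mem => //;
      rewrite /pair_rel !inE eqxx ?orbT.
  - by move=> _ [a _ <-]; apply: root_span_mem => //; rewrite /pair_rel !inE eqxx orbT.
  - by move=> _ [a _ <-]; apply: root_span_mem => //; rewrite /pair_rel !inE eqxx.
  - exact: rank_one_stable.
  - exact: rank_one_stable.
apply: subset_trans (stabiliser_sub (alternate1 N V1 U1)).
apply: root_span_sub; first exact: stabiliser_group.
move=> i j a _; apply: simple_roots_generate; first exact: stabiliser_group.
move=> {}i {}j {}a simple_ij p Pp.
have stable' i' j' : j' = i'.+1 :> nat -> rank_one i' j' (x i j a) ->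
    alternate V U N (x i j a * p) /\ alternate V U N ((x i j a)^-1 * p).
  move=> ji L; split; apply: (stable _ _ ji) => //.
  by have [_ _] := root_span_group x (pair_rel i' j'); apply.
by case: simple_ij => e; [apply: (stable' _ _ e) | apply: (stable' _ _ e)];
  apply: root_span_mem; rewrite ?/pair_rel ?inE ?eqxx ?orbT // -val_eqE /= e; lia.
Qed.

End SteinbergFinite.

(** * Cosets *)
Section Cosets.
Variable G : groupType.
Implicit Types (N M K T : set G).

Lemma mem_lcoset N x y : lcoset N x y <-> N (x^-1 * y).
Proof.
split=> [[h Nh <-]|Nxy]; first by rewrite mulKg.
by exists (x^-1 * y); rewrite // mulVKg.
Qed.

Lemma lcoset_refl N x : is_group N -> lcoset N x x.
Proof. by move=> [N1 _ _]; apply/mem_lcoset; rewrite mulVg. Qed.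

Lemma lcoset_eq N x y : is_group N -> lcoset N x y -> lcoset N x = lcoset N y.
Proof.
move=> [_ NM NV] /mem_lcoset Nxy.
apply/seteqP; split=> z /mem_lcoset Nz; apply/mem_lcoset.
  by have := NM _ _ (NV _ Nxy) Nz; gsimp.
by have := NM _ _ Nxy Nz; gsimp.
Qed.

Lemma finite_index_sup N M K : is_group N -> is_group M -> N `<=` M -> M `<=` K ->
  finite_index N K -> finite_index M K.
Proof.
move=> gN gM NM MK [_ fN]; split=> //.
pose F A := [set g | exists2 a, A a & M (a^-1 * g)].
apply: sub_finite_set (finite_image F fN).
move=> _ [x Kx <-]; exists (lcoset N x); first by exists x.
apply/seteqP; split=> z; last first.
  by move/mem_lcoset => Mz; exists x => //; exact: lcoset_refl.
move=> [a /mem_lcoset/NM Ma Maz]; apply/mem_lcoset.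
by have [_ MM _] := gM; have := MM _ _ Ma Maz; gsimp.
Qed.

(** Two of the [d + 1] cosets of [1, g, ..., g ^+ d] agree, where [d] is the
    index, so some power [g ^+ e] with [0 < e <= d] lies in [T]; then [d`!] works
    for all [g] at once. *)
Lemma finite_index_exponent T K : is_group T -> is_group K -> finite_index T K ->
  exists2 k, (0 < k)%N & forall g, K g -> T (g ^+ k).
Proof.
move=> gT gK [_ /finite_seqP[s es]]; exists (size s)`!; first exact: fact_gt0.
move=> g Kg.
pose c := [seq lcoset T (g ^+ i) | i <- iota 0 (size s).+1].
have cs : {subset c <= s}.
  move=> A /mapP[i _ ->]; suff : [set` s] (lcoset T (g ^+ i)) by [].
  by rewrite -es; exists (g ^+ i) => //; apply: is_groupX.
have /(uniqPn set0)[i [j [lt_ij lt_j]]] : ~~ uniq c.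
  by apply/negP => /uniq_leq_size/(_ cs); rewrite size_map size_iota ltnn.
rewrite size_map size_iota in lt_j.
have szi := ltn_trans lt_ij lt_j.
rewrite !(nth_map 0%N) ?size_iota // !nth_iota // !add0n => eij.
have : lcoset T (g ^+ i) (g ^+ j) by rewrite eij; exact: lcoset_refl.
move/mem_lcoset; rewrite -(subnKC (ltnW lt_ij)) expgnDr mulKg => Tg.
have /dvdnP[q ->] : (j - i %| (size s)`!)%N by apply: dvdn_fact; lia.
by rewrite mulnC expgnA; apply: is_groupX.
Qed.

Lemma conj_group T y : is_group T -> is_group [set g | T (g ^ y)].
Proof.
move=> [T1 TM TV]; split=> [|g h /= Tg Th|g /= Tg]; first by rewrite /= conj1g.
  by rewrite conjMg; apply: TM.
by rewrite conjVg; apply: TV.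
Qed.

Lemma finite_index_conj T K y : is_group K -> K y -> finite_index T K ->
  finite_index [set g | T (g ^ y)] K.
Proof.
move=> [_ KM KV] Ky [TK fT]; split.
  move=> g /= /TK Kg; have := KM _ _ (KM _ _ Ky Kg) (KV _ Ky).
  by rewrite conjgE; gsimp.
pose F A := [set u : G | A (u ^ y)].
apply: sub_finite_set (finite_image F fT) => _ [z Kz <-].
exists (lcoset T (z ^ y)).
  exists (z ^ y) => //; rewrite conjgE; apply: (KM) => //; [exact: KV | exact: KM].
apply/seteqP; split=> u.
  by move=> /= /mem_lcoset Tu; apply/mem_lcoset; rewrite /= conjMg conjVg.
by move/mem_lcoset => /= Tu; apply/mem_lcoset; rewrite -conjVg -conjMg.
Qed.

End Cosets.

(** * Quotient map *)
Section QuotientMap.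
Variables (G : groupType) (N : subgroup G).

(** The junk value [1] is taken outside the normaliser, where the coset is not
    an element of the quotient type. *)
Definition coset_map (g : G) : coset_of N := insubd (1 : coset_of N) (lcoset N g).

Lemma val_coset_map g : normaliser N g -> val (coset_map g) = lcoset N g.
Proof. by move=> ng; rewrite val_insubd; case: asboolP => // -[]; exists g. Qed.

(** A coset is determined by any one of its elements; this avoids computing with
    products of cosets. *)
Lemma coset_mapE (A : coset_of N) g : val A g -> coset_map g = A.
Proof.
have /asboolP[x nx e] := valP A; rewrite e => gA.
have e' := lcoset_eq (subgroupP N) gA.
apply: val_inj; rewrite val_insubd e -e'; case: asboolP => // -[].
by exists x.
Qed.

Lemma coset_mapM x y : normaliser N x -> normaliser N y ->
  coset_map (x * y) = coset_map x * coset_map y.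
Proof.
move=> nx ny; apply: coset_mapE; exists x; last exists y => //.
  by rewrite val_coset_map //; apply/lcoset_refl/subgroupP.
by rewrite val_coset_map //; apply/lcoset_refl/subgroupP.
Qed.

Lemma coset_map_eq1 x : normaliser N x -> coset_map x = 1 <-> subgroup_set N x.
Proof.
move=> nx; split=> [e|Nx]; last exact: coset_mapE.
have -> : subgroup_set N = val (1 : coset_of N) by [].
by rewrite -e val_coset_map //; apply/lcoset_refl/subgroupP.
Qed.

Lemma quotient_coset_map (H : set G) x : H `<=` normaliser N -> H x ->
  quotient N H (coset_map x).
Proof. by move=> HN Hx; exists x => //; rewrite val_coset_map //; exact: HN. Qed.

Lemma normaliser_conj x y : normaliser N y ->
  subgroup_set N x -> subgroup_set N (x ^ y).
Proof.
move=> ny Nx; have : rcoset N y (x * y) by exists x.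
by rewrite -ny => /mem_lcoset; rewrite conjgE.
Qed.

Lemma normaliserP (K : set G) : is_group K ->
  (forall x y, K y -> subgroup_set N x -> subgroup_set N (x ^ y)) ->
  K `<=` normaliser N.
Proof.
move=> [_ _ KV] NK y Ky; apply/seteqP; split.
  move=> _ [h Nh <-]; exists (h ^ y^-1); first by apply: NK => //; apply: KV.
  by rewrite conjgE; gsimp.
move=> _ [h Nh <-]; exists (h ^ y); first exact: NK.
by rewrite conjgE; gsimp.
Qed.

End QuotientMap.

(** * Homomorphisms defined on a subgroup *)
Section PartialMorphism.
Variables (G Q : groupType) (T : set G) (h : G -> Q).
Hypothesis gT : is_group T.
Hypothesis hM : forall x y, T x -> T y -> h (x * y) = h x * h y.

Lemma pmorph1 : h 1 = 1.
Proof. by have [T1 _ _] := gT; apply: (mulgI (h 1)); rewrite -hM // !mulg1. Qed.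

Lemma pmorphV x : T x -> h x^-1 = (h x)^-1.
Proof.
move=> Tx; have [_ _ TV] := gT; apply: (mulgI (h x)).
by rewrite -hM ?mulgV ?pmorph1 //; exact: TV.
Qed.

Lemma pmorphX x k : T x -> h (x ^+ k) = h x ^+ k.
Proof.
move=> Tx; elim: k => [|k IH]; first by rewrite !expg0 pmorph1.
by rewrite !expgS hM ?IH //; apply: is_groupX.
Qed.

Lemma pmorph_image_group : is_group (h @` T).
Proof.
have [T1 TM TV] := gT; split; first by exists 1; rewrite ?pmorph1.
  by move=> _ _ [x Tx <-] [y Ty <-]; exists (x * y); [exact: TM | rewrite hM].
by move=> _ [x Tx <-]; exists x^-1; [exact: TV | rewrite pmorphV].
Qed.

Lemma pmorph_preim_group (H : set Q) : is_group H -> is_group [set g | T g /\ H (h g)].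
Proof.
have [T1 TM TV] := gT.
move=> [H1 HM HV]; split=> [|x y [Tx Hx] [Ty Hy]|x [Tx Hx]].
- by rewrite /= pmorph1.
- by rewrite /= hM //; split; [exact: TM | exact: HM].
- by rewrite /= pmorphV //; split; [exact: TV | exact: HV].
Qed.

(** A coset of the preimage is determined by its coset [A] of [T], together with
    the coset of [H] that contains its image after translation by a chosen
    representative of [A]. *)
Lemma finite_index_preim (K : set G) (H : set Q) : is_group H -> finite_index T K ->
  finite_index H [set: Q] -> finite_index [set g | T g /\ H (h g)] K.
Proof.
move=> gH [TK fT] [_ fH]; split; first by move=> g [/TK].
have [T1 TM TV] := gT; have [H1 HM HV] := gH.
pose F A B := [set g | T ((xget 1 A)^-1 * g) /\ B (h ((xget 1 A)^-1 * g))].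
apply: sub_finite_set (finite_image2 F fT fH).
move=> _ [y Ky <-]; exists (lcoset T y); first by exists y.
set z := xget 1 (lcoset T y).
have Tyz : T (y^-1 * z).
  by apply/mem_lcoset; apply: (xgetPex 1); exists y; exact: lcoset_refl.
have Tzy : T (z^-1 * y) by have := TV _ Tyz; gsimp.
exists (lcoset H (h (z^-1 * y))); first by exists (h (z^-1 * y)).
have e g : T (y^-1 * g) -> h (y^-1 * g) = (h (z^-1 * y))^-1 * h (z^-1 * g).
  move=> Tyg; have Tzg : T (z^-1 * g) by have := TM _ _ Tzy Tyg; gsimp.
  have -> : y^-1 * g = (z^-1 * y)^-1 * (z^-1 * g) by gsimp.
  by rewrite hM ?pmorphV //; exact: TV.
apply/seteqP; split=> g.
  move=> [/= Tzg /mem_lcoset Hg]; apply/mem_lcoset => /=.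
  have Tyg : T (y^-1 * g) by have := TM _ _ Tyz Tzg; gsimp.
  by rewrite e.
move/mem_lcoset => /= [Tyg]; rewrite e // => Hg; split => /=.
  by have := TM _ _ Tzy Tyg; gsimp.
exact/mem_lcoset.
Qed.

End PartialMorphism.

(** * Length functions *)
Section Length.
Variable K : realType.

(** Conjugation by [b ^+ q] turns [a] into [c ^+ q * a].  These elements have the
    same length, and [c ^+ q] is the product of the commuting elements
    [c ^+ q * a] and [a^-1], so [q * l c <= 2 * l a] for all [q]. *)
Lemma length_heisenberg (G : groupType) (l : G -> K) a b c : length_function l ->
  a * b = c * (b * a) -> commute c a -> commute c b -> l c = 0%R.
Proof.
move=> [l0 lX lJ lD] abc ca cb.
have lXn g q : l (g ^+ q) = (q%:R * l g)%R by rewrite -(lX g (Posz q)).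
have lV g : l g^-1 = l g by have := lX g (Negz 0); rewrite /= expg1 mul1r.
have c_b : c ^ b = c by rewrite conjgE cb mulKg.
have a_b : a ^ b = c * a by rewrite conjgE abc (mulgA c) cb -mulgA mulKg.
have conj_b q : a ^ (b ^+ q) = c ^+ q * a.
  elim: q => [|q IH]; first by rewrite !expg0 conjg1 mul1g.
  by rewrite !expgSr conjgM IH conjMg conjXg c_b a_b mulgA.
have bound q : (q%:R * l c <= l a + l a)%R.
  rewrite -lXn -{2}(lV a) -{1}(lJ a (b ^- q)) invgK -mulgA -conjgE conj_b.
  rewrite -{1}[c ^+ q](mulgK a); apply: lD.
  apply: commuteV; apply: commute_sym; apply: commuteM => //.
  by apply: commuteX; apply: commute_sym.
apply/eqP; rewrite eq_le l0 andbT leNgt; apply/negP => lc.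
have := archi_boundP (divr_ge0 (addr_ge0 (l0 a) (l0 a)) (ltW lc)).
by rewrite ltr_pdivrMr // ltNge bound.
Qed.

(** The length function is used only on the subgroup generated by [a] and [b],
    which contains [c] as their commutator. *)
Lemma heisenberg_torsion (Q : groupType) (H : set Q) a b c :
  (forall F : subgroup Q, F `<=` H -> fg_subgroup F ->
     exists l : subgroup_sort F -> K, length_function l /\ purely_positive l) ->
  is_group H -> H a -> H b ->
  a * b = c * (b * a) -> commute c a -> commute c b ->
  exists2 k, (0 < k)%N & c ^+ k = 1.
Proof.
move=> Hlen gH Ha Hb abc ca cb.
pose F := Subgroup ((group_closedP _).2 (generated_group [set` [:: a; b]])).
have gF : is_group F := subgroupP F.
have [_ FM FV] := gF.
have Fa : subgroup_set F a by apply: sub_generated; rewrite /= inE eqxx.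
have Fb : subgroup_set F b by apply: sub_generated; rewrite /= !inE eqxx orbT.
have Fc : subgroup_set F c.
  have -> : c = a * b * (a^-1 * b^-1) by rewrite abc; gsimp.
  by apply: (FM); apply: (FM) => //; apply: FV.
have [||l [ll lp]] := Hlen F.
- apply: generated_min => // g /=; rewrite !inE => /orP[] /eqP-> //.
- by exists [:: a; b].
pose u := SubgroupElt (mem_set Fa); pose v := SubgroupElt (mem_set Fb).
pose w := SubgroupElt (mem_set Fc).
have lw : l w = 0%R.
  by apply: (length_heisenberg (a := u) (b := v) ll); apply: val_inj.
apply: contrapT => nt; suff : (0 < l w)%R by rewrite lw ltxx.
apply: lp => k k0 /(congr1 val) e; apply: nt; exists k => //.
rewrite -[RHS]e; elim: k {k0 e} => [|k IH] //.
by rewrite !expgS IH.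
Qed.

End Length.

(** * Elementary matrices *)
Section Elementary.
Variables (R : pzRingType) (n : nat).
Implicit Types (i j k l : 'I_n) (a b : R).

(** The scalar [b] passes through a matrix unit although the ring is not
    commutative, since the entries of the unit are [0] and [1]. *)
Lemma mul_scaled_delta i j k l a b :
  (a *: delta_mx i j *m (b *: delta_mx k l) =
   (a * b) *: delta_mx i l *+ (j == k) :> 'M[R]_n)%R.
Proof.
apply/matrixP => p q; rewrite mxE (bigD1 j) //= big1 ?addr0 => [|s sj]; last first.
  by rewrite !mxE (negPf sj) andbF mulr0 mul0r.
rewrite !mxE eqxx andbT; case: (j == k); rewrite ?mulr1n ?mulr0n !mxE /=.
  by case: (p == i); case: (q == l); rewrite ?mulr1 ?mulr0 ?mul0r.
by rewrite !mulr0.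
Qed.

Lemma elementary_mxM i j k l a b :
  (elementary_mx i j a * elementary_mx k l b =
   1%:M + b *: delta_mx k l + a *: delta_mx i j +
   (a * b) *: delta_mx i l *+ (j == k) :> 'M[R]_n)%R.
Proof.
rewrite /elementary_mx -[LHS]/(_ *m _)%R mulmxDl mul1mx mulmxDr mulmx1.
by rewrite mul_scaled_delta !addrA.
Qed.

Lemma elementary_mxD i j a b : i != j ->
  (elementary_mx i j a * elementary_mx i j b = elementary_mx i j (a + b))%R.
Proof.
move=> ij; rewrite elementary_mxM eq_sym (negPf ij) mulr0n addr0.
by rewrite /elementary_mx scalerDl -addrA (addrC (a *: _)%R).
Qed.

Lemma elementary_invertible i j a : i != j -> invertible (elementary_mx i j a).
Proof.
move=> ij; exists (elementary_mx i j (- a)).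
by rewrite !elementary_mxD // addrN addNr /elementary_mx scale0r addr0.
Qed.

Definition elementary i j a : GL R n :=
  insubd (1 : GL R n) (elementary_mx i j a).

Lemma val_elementary i j a : i != j -> val (elementary i j a) = elementary_mx i j a.
Proof.
move=> ij; rewrite val_insubd; case: asboolP => // -[].
exact: elementary_invertible.
Qed.

Lemma elementary_steinberg : steinberg elementary.
Proof.
split=> [i j a b ij|i j k l a b ij kl jk il|i j k a b ij jk ik]; apply: val_inj => /=.
- by rewrite !val_elementary // elementary_mxD.
- rewrite !val_elementary // !elementary_mxM (negPf jk) eq_sym (negPf il).
  by rewrite !mulr0n !addr0 addrAC.
- rewrite !val_elementary // !elementary_mxM eqxx mulr1n eq_sym (negPf ik) mulr0n addr0.
  rewrite /elementary_mx -[RHS]/(_ *m _)%R mulmxDl mul1mx !mulmxDr mulmx1.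
  rewrite !mul_scaled_delta (eq_sym k j) (negPf jk) (eq_sym k i) (negPf ik) !mulr0n !addr0.
  by congr (_ + _)%R; rewrite addrAC.
Qed.

Lemma E_root_span : E R n = root_span elementary (fun _ _ => true).
Proof.
congr generated; apply/seteqP; split=> u [i [j [a]]].
  move=> [ij e]; exists i, j, a; split=> //; apply: val_inj.
  by rewrite val_elementary.
by move=> [_ ij ->]; exists i, j, a; rewrite val_elementary.
Qed.

Lemma E_group : is_group (E R n).
Proof. by rewrite E_root_span; apply: root_span_group. Qed.

Lemma E_elementary i j a : i != j -> E R n (elementary i j a).
Proof. by move=> ij; rewrite E_root_span; apply: root_span_mem. Qed.

End Elementary.

(** * Homomorphisms from finite-index subgroups of the elementary group *)

Section Rigidity.
Variables (R : nzRingType) (n : nat).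
Hypothesis n3 : (3 <= n)%N.
Local Notation x := (@elementary R n).
Local Notation EE := (E R n).
Let xS : steinberg x := elementary_steinberg R n.

(** The Heisenberg relation first gives a torsion element, hence one integer [m]
    with [x i j m] in the kernel.  A commutator with an element of [T] then
    spreads this over all multiples, as the kernel is normal in [T]. *)
Lemma kernel_contains_multiples (K : realType) (Q : groupType) (T : set (GL R n))
    (h : GL R n -> Q) :
  is_group T -> finite_index T EE ->
  (forall u v, T u -> T v -> h (u * v) = h u * h v) ->
  (forall F : subgroup Q, F `<=` h @` T -> fg_subgroup F ->
     exists l : subgroup_sort F -> K, length_function l /\ purely_positive l) ->
  forall i j : 'I_n, i != j -> exists2 m, (0 < m)%N &
    forall r, T (x i j (r *+ m)%R) /\ h (x i j (r *+ m)%R) = 1.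
Proof.
move=> gT fT hM Hlen.
have [k k0 kT] := finite_index_exponent gT (E_group R n) fT.
have Tx (i j : 'I_n) r : i != j -> T (x i j (r *+ k)%R).
  by move=> ij; rewrite (steinbergMn xS) //; apply: kT; apply: E_elementary.
have gI := pmorph_image_group gT hM.
have unit_case (i j : 'I_n) : i != j -> exists2 m, (0 < m)%N &
    T (x i j (1 *+ m)%R) /\ h (x i j (1 *+ m)%R) = 1.
  move=> ij; have [s /andP[si sj]] := ord_third i j n3.
  have is_ : i != s by rewrite eq_sym.
  have e : (1 *+ k * (1 *+ k) = 1 *+ k *+ k :> R)%R by rewrite mulr_natr.
  have Tc : T (x i j (1 *+ k * (1 *+ k))%R) by rewrite e; apply: Tx.
  have [] := @heisenberg_torsion K Q (h @` T) (h (x i s (1 *+ k)%R))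
     (h (x s j (1 *+ k)%R)) (h (x i j (1 *+ k * (1 *+ k))%R)) Hlen gI.
  - by exists (x i s (1 *+ k)%R) => //; apply: Tx.
  - by exists (x s j (1 *+ k)%R) => //; apply: Tx.
  - have [_ TM _] := gT; rewrite -!hM //; try exact: Tx.
      by congr h; rewrite (steinbergM xS).
    by apply: TM; apply: Tx.
  - rewrite /commute -!hM //; try exact: Tx.
    by congr h; apply: (steinberg_commute xS) => //; rewrite eq_sym.
  - rewrite /commute -!hM //; try exact: Tx.
    by congr h; apply: (steinberg_commute xS) => //; rewrite eq_sym.
  move=> t t0 ct; exists (k * k * t)%N; first by rewrite !muln_gt0 k0 t0.
  have -> : (1 *+ (k * k * t) = 1 *+ k * (1 *+ k) *+ t :> R)%R by rewrite e !mulrnA.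
  rewrite (steinbergMn xS) //; split; first exact: is_groupX.
  by rewrite (pmorphX gT hM).
move=> i j ij; have [s /andP[si sj]] := ord_third i j n3.
have is_ : i != s by rewrite eq_sym.
have [m m0 [Tm hm]] := unit_case i s is_.
exists (m * k)%N; first by rewrite muln_gt0 m0.
move=> r.
have -> : (r *+ (m * k) = 1 *+ m * (r *+ k))%R by rewrite mulr_natl mulrnA mulrnAC.
rewrite (steinberg_commutator xS _ _ is_ sj ij).
have Ts := Tx s j r sj; have [_ TM TV] := gT.
have T1 := TM _ _ Tm Ts; have T2 := TM _ _ T1 (TV _ Tm).
split; first by apply: (TM) => //; exact: TV.
rewrite hM //; last exact: TV.
rewrite hM //; last exact: TV.
by rewrite hM // !(pmorphV gT hM) // hm invg1 mul1g mulg1 mulgV.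
Qed.

Hypothesis hchar : char_zero R.
Hypothesis hideal : forall I : set R,
  two_sided_ideal I -> I <> [set 0%R] -> ideal_finite_index I.

Lemma finite_quotient_multiples m : (0 < m)%N ->
  finite_set [set [set (r + a *+ m)%R | a in [set: R]] | r in [set: R]].
Proof.
move=> m0; pose I : set R := [set (a *+ m)%R | a in [set: R]].
have idI : two_sided_ideal I.
  split.
    split=> [|_ _ /set_mem[a _ <-] /set_mem[b _ <-]]; apply: mem_set.
      by exists 0%R; rewrite ?mul0rn.
    by exists (a - b)%R; rewrite ?mulrnBl.
  by move=> a _ [b _ <-]; split; [exists (a * b)%R | exists (b * a)%R];
    rewrite ?mulrnAr ?mulrnAl.
have /(hideal idI) : I <> [set 0%R].
  move=> I0; have : I (1 *+ m)%R by exists 1%R.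
  by rewrite I0 => /hchar m00; rewrite m00 in m0.
congr finite_set; apply: eq_imagel => r _; apply/seteqP; split.
  by move=> _ [_ [a _ <-] <-]; exists a.
by move=> _ [a _ <-]; exists (a *+ m)%R => //; exists a.
Qed.

(** The root elements of the quotient satisfy the Steinberg relations and take
    finitely many values, because they only see the ring modulo [m]. *)
Lemma finite_index_multiples (N : subgroup (GL R n)) m : (0 < m)%N ->
  N `<=` EE -> (forall u y, EE y -> subgroup_set N u -> subgroup_set N (u ^ y)) ->
  (forall (i j : 'I_n) r, i != j -> subgroup_set N (x i j (r *+ m)%R)) ->
  finite_index N EE.
Proof.
move=> m0 NE Nn Nx; split=> //.
have EN : EE `<=` normaliser N by apply: normaliserP => //; exact: E_group.
have [_ EM EV] := E_group R n.
have pM u v : EE u -> EE v -> coset_map N (u * v) = coset_map N u * coset_map N v.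
  by move=> Eu Ev; apply: coset_mapM; apply: EN.
pose z i j r := coset_map N (x i j r).
have zS : steinberg z.
  have Ex i j r : i != j -> EE (x i j r) by exact: E_elementary.
  split=> [i j a b ij|i j k l a b ij kl jk il|i j k a b ij jk ik]; rewrite /z.
  - by rewrite (steinbergD xS) // pM //; apply: Ex.
  - rewrite /commute -!pM; try exact: Ex.
    by rewrite (steinberg_commute xS a b ij kl jk il).
  - rewrite -!pM; try exact: Ex; first by rewrite (steinbergM xS a b ij jk ik).
    by apply: EM; apply: Ex.
have zm i j r : i != j -> z i j (r *+ m)%R = 1.
  by move=> ij; apply/coset_map_eq1; [apply: EN; apply: E_elementary | apply: Nx].
have zfin i j : i != j -> finite_set (root_group z i j).
  move=> ij; pose F (A : set R) := z i j (xget 0%R A).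
  apply: sub_finite_set (finite_image F (finite_quotient_multiples m0)).
  move=> _ [r _ <-].
  exists [set (r + a *+ m)%R | a in [set: R]]; first by exists r.
  rewrite /F; case: xgetP => [_ -> [a _ <-]|/(_ r)[]].
    by rewrite (steinbergD zS) // zm // mulg1.
  by exists 0%R; rewrite ?mul0rn ?addr0.
have Efin := finite_steinberg n3 zS zfin m0 zm.
apply: sub_finite_set (finite_image val Efin) => _ [u Eu <-].
exists (coset_map N u); last by rewrite val_coset_map //; exact: EN.
have [s1 sM sV] := root_span_group z (fun _ _ => true).
suff : EE `<=` [set u | EE u /\ root_span z (fun _ _ => true) (coset_map N u)].
  by move=> /(_ u Eu)[].
rewrite {1}E_root_span; apply: root_span_sub.
  exact: (pmorph_preim_group (E_group R n) pM (root_span_group _ _)).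
move=> i j a _ ij; split; first exact: E_elementary.
exact: (@root_span_mem _ _ _ z).
Qed.

(** The preimage [T1] of [N] is normal in [T] but maybe not in the elementary
    group, while [finite_index_multiples] needs a normal subgroup; so the core
    [N0] of [T1] is used.  It is an intersection of finitely many conjugates, one
    for each coset of [T]. *)
Lemma finite_index_descend (K : realType) (G : groupType) (H N : subgroup G)
    (T : set (GL R n)) (f : GL R n -> G) :
  is_group T -> finite_index T EE ->
  (forall u v, T u -> T v -> f (u * v) = f u * f v) -> f @` T `<=` H ->
  normal N H ->
  (forall F : subgroup (coset_of N), F `<=` quotient N H -> fg_subgroup F ->
     exists l : subgroup_sort F -> K, length_function l /\ purely_positive l) ->
  finite_index [set u | T u /\ subgroup_set N (f u)] EE.
Proof.
move=> gT fT fM fTH [NH HN] Hlen; have gE := E_group R n.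
have [_ TM TV] := gT; have [_ EM EV] := gE.
pose T1 : set (GL R n) := [set u | T u /\ subgroup_set N (f u)].
have gT1 : is_group T1 by exact: (pmorph_preim_group gT fM (subgroupP N)).
have [T11 T1M T1V] := gT1.
have T1n u t : T t -> T1 u -> T1 (u ^ t).
  move=> Tt [Tu Nu]; have TVt := TV _ Tt; have Tut := TM _ _ Tu Tt.
  rewrite /T1 /= conjgE; split; first exact: TM.
  rewrite fM // fM // (pmorphV gT fM) // -conjgE.
  by apply: normaliser_conj => //; apply: HN; apply: fTH; exists t.
(* The conjugate by [y] of [T1] is the kernel of a homomorphism from the
   conjugate of [T] to the quotient. *)
have one_conjugate y : EE y -> forall i j : 'I_n, i != j ->
    exists2 m, (0 < m)%N & forall r, T1 (x i j (r *+ m)%R ^ y).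
  move=> Ey i j ij.
  have gTy := conj_group y gT; have fTy := finite_index_conj gE Ey fT.
  have nTy u : T u -> normaliser N (f u).
    by move=> Tu; apply: HN; apply: fTH; exists u.
  have [||m m0 mh] := @kernel_contains_multiples K _ _
      (fun u => coset_map N (f (u ^ y))) gTy fTy _ _ i j ij.
  - by move=> u v Tu Tv; rewrite conjMg fM // coset_mapM //; apply: nTy.
  - move=> F FT; apply: Hlen; apply: subset_trans FT _ => _ [u Tu <-].
    by apply: quotient_coset_map => //; apply: fTH; exists (u ^ y).
  exists m => // r; have [Tr /coset_map_eq1 Nr] := mh r; split=> //.
  by apply: Nr; apply: nTy.
(* One [m] for all [y]: conjugating [T1] by [y] only depends on the coset of [T]
   containing [y]. *)
have [m m0 mT1] : exists2 m, (0 < m)%N & forall y (i j : 'I_n) r, EE y -> i != j ->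
    T1 (x i j (r *+ m)%R ^ y).
  have [_ /finite_seqP[s es]] := fT.
  have sP y : EE y -> lcoset T y \in s.
    by move=> Ey; suff : [set` s] (lcoset T y) by []; rewrite -es; exists y.
  pose P (A : set (GL R n)) m := forall y (i j : 'I_n) r, EE y -> A y -> i != j ->
    T1 (x i j (r *+ m)%R ^ y).
  have [||m m0 mP] := @common_multiple _ s P.
  - by move=> A m k Pm y i j r Ey Ay ij; rewrite mulnC mulrnA; apply: Pm.
  - move=> A As; have : [set` s] A by [].
    rewrite -es => -[y Ey <-].
    have [||m m0 mp] := @common_multiple _ (enum {: 'I_n * 'I_n})
      (fun p m => p.1 != p.2 -> forall r, T1 (x p.1 p.2 (r *+ m)%R ^ y)).
    + by move=> p m k pm p12 r; rewrite mulnC mulrnA; apply: pm.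
    + move=> [i j] _ /=; have [->|ij] := eqVneq i j; first by exists 1%N.
      by have [m m0 mr] := one_conjugate y Ey i j ij; exists m.
    exists m => // y' i j r Ey' /mem_lcoset Ty' ij.
    rewrite -(mulVKg y y') conjgM; apply: T1n => //.
    by apply: (mp (i, j)); rewrite ?mem_enum.
  exists m => // y i j r Ey ij; apply: (mP (lcoset T y)) => //; first exact: sP.
  exact: lcoset_refl.
pose N0 : set (GL R n) := [set u | forall y, EE y -> T1 (u ^ y)].
have gN0 : is_group N0.
  split=> [y _|u v Nu Nv y Ey|u Nu y Ey]; first by rewrite conj1g.
    by rewrite conjMg; apply: T1M; [apply: Nu | apply: Nv].
  by rewrite conjVg; apply: T1V; apply: Nu.
have N0T1 : N0 `<=` T1.
  by move=> u /(_ 1); rewrite conjg1; apply; case: gE.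
have T1E : T1 `<=` EE by move=> u [Tu _]; case: fT => TE _; apply: TE.
apply: (finite_index_sup gN0 gT1 N0T1 T1E).
apply: (@finite_index_multiples (Subgroup ((group_closedP N0).2 gN0)) m) => //=.
- exact: subset_trans N0T1 T1E.
- by move=> u y Ey Nu y' Ey'; rewrite -conjgM; apply: Nu; apply: EM.
- by move=> i j r ij y Ey; apply: mT1.
Qed.

End Rigidity.

Theorem theorem0p8 (K : realType) (G : groupType)
    (hG : virtually_poly_positive K G)
    (R : nzRingType) (hfg : fg_ring R) (hchar : char_zero R)
    (hideal : forall I : set R,
       two_sided_ideal I -> I <> [set 0%R] -> ideal_finite_index I)
    (n : nat) (hn : (3 <= n)%N)
    (S : subgroup (GL R n)) (hS : finite_index S (E R n))
    (f : {multiplicative subgroup_sort S -> G}) :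
  finite_set (range f).
Proof.
have [H [finH [p [H_ [H0 Hp Hstep]]]]] := hG.
(* Extending [f] by [1] outside [S] lets all its restrictions be handled as one
   function on the whole linear group. *)
pose g (u : GL R n) : G := if insub u is Some v then f v else 1.
have gval (v : subgroup_sort S) : g (val v) = f v by rewrite /g valK.
have gM u v : subgroup_set S u -> subgroup_set S v -> g (u * v) = g u * g v.
  move=> Su Sv; have [Su' Sv'] := (mem_set Su, mem_set Sv).
  rewrite -[u]/(val (SubgroupElt Su')) -[v]/(val (SubgroupElt Sv')).
  by rewrite -gmulfM !gval gmulfM.
have gS := subgroupP S.
have series i : (i <= p)%N ->
    finite_index [set u | subgroup_set S u /\ subgroup_set (H_ i) (g u)] (E R n).
  elim: i => [_|i IH lt_i].
    by rewrite H0; apply: (finite_index_preim gS gM (subgroupP H)).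
  have gT := pmorph_preim_group gS gM (subgroupP (H_ i)).
  have [nrm len] := Hstep i lt_i.
  have := finite_index_descend hn hchar hideal gT (IH (ltnW lt_i)) _ _ nrm len.
  move=> /(_ g)[||TE fT]; first by move=> u v [Su _] [Sv _]; exact: gM.
    by move=> _ [u [_ Hu] <-].
  have e : [set u | [set u | subgroup_set S u /\ subgroup_set (H_ i) (g u)] u /\
         subgroup_set (H_ i.+1) (g u)]
      = [set u | subgroup_set S u /\ subgroup_set (H_ i.+1) (g u)].
    apply/seteqP; split=> u /=; first by case=> -[].
    by move=> [Su Hu]; have [NH _] := nrm; split=> //; split=> //; apply: NH.
  by rewrite e in TE fT.
have := series p (leqnn p); rewrite Hp.
set T := [set u | _] => -[TE fT].
have gT : is_group T by have := pmorph_preim_group gS gM (subgroupP (H_ p)); rewrite Hp.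
have [SE _] := hS.
pose F (A : set (GL R n)) := g (xget 1 A).
apply: sub_finite_set (finite_image F fT) => _ [v _ <-].
have Sv : subgroup_set S (val v) by apply/set_mem/(valP v).
exists (lcoset T (val v)); first by exists (val v) => //; apply: SE.
rewrite /F -gval; case: xgetP => [_ -> [t [St gt] <-]|/(_ (val v))[]].
  by rewrite gM // gt mulg1.
exact: lcoset_refl.
Qed.
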